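(* Let $N\ge 1$. For $i=1,\dots,N$ let $\Sigma_i$ be the discrete-time LTI system $$x_i^+ = A_i x_i + B_i u_i + G_i w_i,\quad y_i = C^{\mathrm{con}}_i x_i + D^{\mathrm{con}}_i u_i + H^{\mathrm{con}}_i w_i,\quad z_i = C^{\mathrm{opt}}_i x_i + D^{\mathrm{opt}}_i u_i + H^{\mathrm{opt}}_i w_i,$$ closed with the static nonlinear feedback $w_i=\varphi_i(z_i)$, and let these $N$ systems be coupled via $u=My$ for a real matrix $M$, where $u=[u_1^\top\ \cdots\ u_N^\top]^\top$ and $y=[y_1^\top\ \cdots\ y_N^\top]^\top$. Assume that the interconnection is well-posed and that: 1) for each $i$ there is a symmetric matrix $S_{\varphi_i}$ such that, with $$s_{\varphi_i}(\Delta z_i,\Delta w_i)=\begin{bmatrix}\Delta z_i\\ \Delta w_i\end{bmatrix}^\top S_{\varphi_i}\begin{bmatrix}\Delta z_i\\ \Delta w_i\end{bmatrix},$$ one has $s_{\varphi_i}(\Delta z_i,\Delta w_i)\le 0$ for all $\Delta z_i=z_i^1-z_i^2$ and corresponding $\Delta w_i=\varphi_i(z_i^1)-\varphi_i(z_i^2)$; 2) there exist $\gamma\in(0,1)$ and, for each $i$, a scalar $\alpha_i>0$ and matrices $Q_i=Q_i^\top$, $S_i$, $R_i=R_i^\top$ such that the LTI system $\Sigma_i$ (with inputs $u_i,w_i$ and outputs $y_i,z_i$) is incrementally dissipative with dissipation rate $\gamma$ with respect to the supply rate $$s_i(\Delta z_i,\Delta w_i,\Delta y_i,\Delta u_i)=\alpha_i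 s_{\varphi_i}(\Delta z_i,\Delta w_i)+\begin{bmatrix}\Delta y_i\\ \Delta u_i\end{bmatrix}^\top\begin{bmatrix}Q_i&S_i\\ S_i^\top&R_i\end{bmatrix}\begin{bmatrix}\Delta y_i\\ \Delta u_i\end{bmatrix}.$$ Let $Q=\operatorname{diag}(Q_1,\dots,Q_N)$, $S=\operatorname{diag}(S_1,\dots,S_N)$, $R=\operatorname{diag}(R_1,\dots,R_N)$ (block diagonal). If $$\begin{bmatrix}I\\ M\end{bmatrix}^\top\begin{bmatrix}Q&S\\ S^\top&R\end{bmatrix}\begin{bmatrix}I\\ M\end{bmatrix}\preceq 0,$$ then the interconnection, viewed as an autonomous system with state $x=[x_1^\top\ \cdots\ x_N^\top]^\top$, is exponentially contractive with rate $\gamma$.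
   Context: All signals are real and finite-dimensional, with matrices of compatible dimensions; $x^+$ and $x$ denote $x(k+1)$ and $x(k)$. The interconnection is well-posed: for every state $x$, the algebraic equations for $u,y,z,w$ (including $w_i=\varphi_i(z_i)$ and $u=My$) have a unique solution, so the interconnection is an autonomous discrete-time system in $x$. Incremental trajectory: the difference of two trajectories, e.g. $\Delta x=x^1-x^2$, and similarly $\Delta u,\Delta w,\Delta y,\Delta z$. Incremental dissipativity: a discrete-time system with state $x$, input $v$ and output $o$ is incrementally dissipative with respect to a supply rate $s$, with dissipation rate $\gamma\in(0,1]$, if there is a positive definite storage function $V$ such that $V(\Delta x^+)-\gamma V(\Delta x)\le s(\Delta o,\Delta v)$ for all incremental trajectories. Storage functions are taken to be positive definite quadratic, $V(\Delta x)=\Delta x^\top P\Delta x$ with $P\succ0$. For $\Sigma_i$ the input is $(u_i,w_i)$ (both free; the feedback $w_i=\varphi_i(z_i)$ is not imposed) and the output is $(y_i,z_i)$. Exponential contraction: an autonomous discrete-time system with state $x$ is exponentially contractive with rate $\gamma\in(0,1)$ if there is a positive definite quadratic function $V$ such that $V(\Delta x^+)-\gamma V(\Delta x)\le 0$ for every incremental trajectory $\Delta x\ne0$. *)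

(* Defs.v *)
From mathcomp Require Import all_boot all_order all_algebra.
From mathcomp Require Import reals.

Set Implicit Arguments.
Unset Strict Implicit.
Unset Printing Implicit Defensive.

Import Order.TTheory GRing.Theory Num.Theory.
Local Open Scope ring_scope.

Section QuadraticForms.
Context {R : realType}.

Definition qform n (P : 'M[R]_n) (v : 'cV[R]_n) : R := (v^T *m P *m v) 0 0.

Definition posdef n (P : 'M[R]_n) : Prop :=
  P^T = P /\ forall v : 'cV[R]_n, v != 0 -> 0 < qform P v.

Definition negsemidef n (P : 'M[R]_n) : Prop :=
  P^T = P /\ forall v : 'cV[R]_n, qform P v <= 0.

(* The library's mxdiag requires square diagonal blocks; here the i-th block is
   p_ i x q_ i.  When i == j the dimensions agree, so conform_mx returns B_ i. *)
Definition rect_mxdiag N (p_ q_ : 'I_N -> nat)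
    (B_ : forall i, 'M[R]_(p_ i, q_ i)) : 'M[R]_(\sum_i p_ i, \sum_i q_ i) :=
  \mxblock_(i, j) if i == j then conform_mx 0 (B_ i) else 0.

Lemma submxblock_rect_mxdiag N (p_ q_ : 'I_N -> nat)
    (B_ : forall i, 'M[R]_(p_ i, q_ i)) (i : 'I_N) :
  submxblock (rect_mxdiag B_) i i = B_ i.
Proof. by rewrite mxblockK eqxx conform_mx_id. Qed.

Lemma submxblock_rect_mxdiag_neq N (p_ q_ : 'I_N -> nat)
    (B_ : forall i, 'M[R]_(p_ i, q_ i)) (i j : 'I_N) :
  i != j -> submxblock (rect_mxdiag B_) i j = 0.
Proof. by move=> /negbTE ij; rewrite mxblockK ij. Qed.

End QuadraticForms.

Section IncrementalProperties.
Context {R : realType}.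

(* Systems are given by their sets of trajectories over time k = 0, 1, 2, ... *)
Definition io_system n (V O : Type) : Type :=
  (nat -> 'cV[R]_n) -> (nat -> V) -> (nat -> O) -> Prop.

Definition autonomous_system n : Type := (nat -> 'cV[R]_n) -> Prop.

Definition incr_dissipative n (V O : zmodType) (Sys : io_system n V O)
    (s : O -> V -> R) (gamma : R) : Prop :=
  0 < gamma <= 1 /\
  exists P : 'M[R]_n, posdef P /\
    forall x1 v1 o1 x2 v2 o2, Sys x1 v1 o1 -> Sys x2 v2 o2 ->
    forall k, qform P (x1 k.+1 - x2 k.+1) - gamma * qform P (x1 k - x2 k)
                <= s (o1 k - o2 k) (v1 k - v2 k).

(* The incremental trajectory is required to be nonzero as a signal, i.e. at
   some time j; the decrease is then required at every time k. *)
Definition exp_contractive n (Sys : autonomous_system n) (gamma : R) : Prop :=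
  0 < gamma < 1 /\
  exists P : 'M[R]_n, posdef P /\
    forall x1 x2, Sys x1 -> Sys x2 ->
    (exists j, x1 j - x2 j != 0) ->
    forall k,
      qform P (x1 k.+1 - x2 k.+1) - gamma * qform P (x1 k - x2 k) <= 0.

End IncrementalProperties.

Record lti (R : realType) (n nu nw ny nz : nat) := Lti {
  mxA : 'M[R]_(n, n);      mxB : 'M[R]_(n, nu);     mxG : 'M[R]_(n, nw);
  Ccon : 'M[R]_(ny, n);   Dcon : 'M[R]_(ny, nu);  Hcon : 'M[R]_(ny, nw);
  Copt : 'M[R]_(nz, n);   Dopt : 'M[R]_(nz, nu);  Hopt : 'M[R]_(nz, nw)
}.

Section LTI.
Context {R : realType} {n nu nw ny nz : nat} (Sg : lti R n nu nw ny nz).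

Definition lti_next (x : 'cV[R]_n) (u : 'cV[R]_nu) (w : 'cV[R]_nw) : 'cV[R]_n :=
  mxA Sg *m x + mxB Sg *m u + mxG Sg *m w.

Definition lti_con (x : 'cV[R]_n) (u : 'cV[R]_nu) (w : 'cV[R]_nw) : 'cV[R]_ny :=
  Ccon Sg *m x + Dcon Sg *m u + Hcon Sg *m w.

Definition lti_opt (x : 'cV[R]_n) (u : 'cV[R]_nu) (w : 'cV[R]_nw) : 'cV[R]_nz :=
  Copt Sg *m x + Dopt Sg *m u + Hopt Sg *m w.

(* Open loop: input (u, w) with w free, output (y, z). *)
Definition lti_system :
    io_system n ('cV[R]_nu * 'cV[R]_nw)%type ('cV[R]_ny * 'cV[R]_nz)%type :=
  fun x v o => forall k,
    [/\ x k.+1 = lti_next (x k) (v k).1 (v k).2,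
        (o k).1 = lti_con (x k) (v k).1 (v k).2 &
        (o k).2 = lti_opt (x k) (v k).1 (v k).2].

End LTI.

Definition phi_supply {R : realType} nz nw (Sphi : 'M[R]_(nz + nw))
    (dz : 'cV[R]_nz) (dw : 'cV[R]_nw) : R :=
  qform Sphi (col_mx dz dw).

Definition supply {R : realType} nu nw ny nz (Sphi : 'M[R]_(nz + nw))
    (alpha : R) (Q : 'M[R]_ny) (S : 'M[R]_(ny, nu)) (T : 'M[R]_nu)
    (o : 'cV[R]_ny * 'cV[R]_nz) (v : 'cV[R]_nu * 'cV[R]_nw) : R :=
  alpha * phi_supply Sphi o.2 v.2
  + qform (block_mx Q S S^T T) (col_mx o.1 v.1).

Section Interconnection.
Context {R : realType} {N : nat} {n_ nu_ nw_ ny_ nz_ : 'I_N -> nat}.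
Variable Sg : forall i, lti R (n_ i) (nu_ i) (nw_ i) (ny_ i) (nz_ i).
Variable phi : forall i, 'cV[R]_(nz_ i) -> 'cV[R]_(nw_ i).
Variable M : 'M[R]_(\sum_i nu_ i, \sum_i ny_ i).

(* Stacked signals; submxcol x i is the i-th block x_i. *)
Definition algebraic_eqs (x : 'cV[R]_(\sum_i n_ i))
    (u : 'cV[R]_(\sum_i nu_ i)) (y : 'cV[R]_(\sum_i ny_ i))
    (z : 'cV[R]_(\sum_i nz_ i)) (w : 'cV[R]_(\sum_i nw_ i)) : Prop :=
  (forall i, [/\
    submxcol y i = lti_con (Sg i) (submxcol x i) (submxcol u i) (submxcol w i),
    submxcol z i = lti_opt (Sg i) (submxcol x i) (submxcol u i) (submxcol w i) &
    submxcol w i = phi (submxcol z i)])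
  /\ u = M *m y.

Definition well_posed : Prop := forall x, exists! s,
  let: (u, y, z, w) := s in algebraic_eqs x u y z w.

Definition interconnection : autonomous_system (\sum_i n_ i) :=
  fun x => forall k, exists u y z w,
    algebraic_eqs (x k) u y z w /\
    forall i, submxcol (x k.+1) i =
      lti_next (Sg i) (submxcol (x k) i) (submxcol u i) (submxcol w i).

End Interconnection.

(* Main.v *)
(* The sum of the storage functions is a storage function of the interconnection.
   Summing the dissipation inequalities, the terms [alpha_i s_phi_i] are
   nonpositive along the feedback, and the remaining quadratic supplies add up to
   the form of the coupling condition evaluated at the stacked increment of [y],
   because the increment of [u] is [M] times that of [y]. *)
Require Import Defs.
From mathcomp Require Import all_boot all_order all_algebra.
From mathcomp Require Import reals ring.

Set Implicit Arguments.
Unset Strict Implicit.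
Unset Printing Implicit Defensive.

Import Order.TTheory GRing.Theory Num.Theory.
Local Open Scope ring_scope.

Section BlockForms.
Variable R : realType.

Lemma qform_ge0 n (P : 'M[R]_n) v : posdef P -> 0 <= qform P v.
Proof.
case=> _ Ppos; have [->|v0] := eqVneq v 0; last exact: ltW (Ppos v v0).
by rewrite /qform mulmx0 mxE.
Qed.

Lemma qform_congr m n (A : 'M[R]_(m, n)) (P : 'M[R]_m) (v : 'cV[R]_n) :
  qform (A^T *m P *m A) v = qform P (A *m v).
Proof. by rewrite /qform trmx_mul !mulmxA. Qed.

Lemma qform_block_mx m n (Q : 'M[R]_m) (S : 'M[R]_(m, n)) (T : 'M[R]_n) y u :
  qform (block_mx Q S S^T T) (col_mx y u) =
  qform Q y + (y^T *m S *m u) 0 0 *+ 2 + qform T u.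
Proof.
rewrite /qform tr_col_mx mul_row_block mul_row_col !mulmxDl mulr2n.
have mx11D (A B : 'M[R]_1) : (A + B) 0 0 = A 0 0 + B 0 0 by rewrite mxE.
(* The two cross terms are transposes of each other, and a 1 x 1 matrix equals its transpose. *)
rewrite !mx11D; have -> : (u^T *m S^T *m y) 0 0 = (y^T *m S *m u) 0 0.
  by rewrite -(trmxK (u^T *m _ *m y)) mxE !trmx_mul !trmxK mulmxA.
by ring.
Qed.

Lemma mul_rect_mxdiag N (p_ q_ : 'I_N -> nat)
    (B_ : forall i, 'M[R]_(p_ i, q_ i)) (y : 'cV[R]_(\sum_i p_ i))
    (u : 'cV[R]_(\sum_i q_ i)) :
  (y^T *m rect_mxdiag B_ *m u) 0 0 =
  \sum_i ((submxcol y i)^T *m B_ i *m submxcol u i) 0 0.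
Proof.
rewrite -{1}(submxcolK y) -{1}(submxcolK u) tr_mxcol mul_mxrow_mxblock.
rewrite mul_mxrow_mxcol summxE; apply: eq_bigr => i _.
rewrite (bigD1 i) //= eqxx conform_mx_id big1 ?addr0 // => j /negPf ->.
by rewrite mulmx0.
Qed.

Lemma qform_mxdiag N (p_ : 'I_N -> nat) (B_ : forall i, 'M[R]_(p_ i)) v :
  qform (\mxdiag_i B_ i) v = \sum_i qform (B_ i) (submxcol v i).
(* For square blocks, [rect_mxdiag] and [\mxdiag] are convertible. *)
Proof. exact: (mul_rect_mxdiag B_). Qed.

(** A sum of nonnegative block forms vanishes only if every term does, which forces each block of
    the vector, hence the vector, to be zero. *)
Lemma posdef_mxdiag N (p_ : 'I_N -> nat) (P_ : forall i, 'M[R]_(p_ i)) :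
  (forall i, posdef (P_ i)) -> posdef (\mxdiag_i P_ i).
Proof.
move=> P_pos; split=> [|v v0].
  by rewrite tr_mxdiag; apply: eq_mxdiag => i; case: (P_pos i).
rewrite qform_mxdiag lt_def sumr_ge0 ?andbT; last first.
  by move=> i _; exact: qform_ge0.
apply: contra_neq v0 => /eqP; rewrite psumr_eq0; last first.
  by move=> i _; exact: qform_ge0.
move=> /allP v0; apply/mxcolP => i; rewrite submxcol0.
apply: contraTeq (v0 i (mem_index_enum i)) => vi0.
by rewrite /= gt_eqF //; case: (P_pos i) => _; exact.
Qed.

(** Regrouping coordinates by subsystem instead of by signal turns the coupling matrix into a block
    diagonal of the local supply matrices. *)
Lemma qform_interconnection N (p_ q_ : 'I_N -> nat)
    (Q_ : forall i, 'M[R]_(p_ i)) (S_ : forall i, 'M[R]_(p_ i, q_ i))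
    (T_ : forall i, 'M[R]_(q_ i)) y u :
  qform (block_mx (\mxdiag_i Q_ i) (rect_mxdiag S_) (rect_mxdiag S_)^T
           (\mxdiag_i T_ i)) (col_mx y u) =
  \sum_i qform (block_mx (Q_ i) (S_ i) (S_ i)^T (T_ i))
           (col_mx (submxcol y i) (submxcol u i)).
Proof.
rewrite qform_block_mx !qform_mxdiag mul_rect_mxdiag -sumrMnl -!big_split /=.
by apply: eq_bigr => i _; rewrite qform_block_mx.
Qed.

End BlockForms.

(* Any single step extends to a full open-loop trajectory by holding the input
   constant. *)
Lemma lti_dissipative_step (R : realType) n nu nw ny nz
    (Sg : lti R n nu nw ny nz)
    (s : 'cV[R]_ny * 'cV[R]_nz -> 'cV[R]_nu * 'cV[R]_nw -> R) gamma :
  incr_dissipative (lti_system Sg) s gamma ->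
  exists2 P : 'M[R]_n, posdef P & forall x1 u1 w1 x2 u2 w2,
    qform P (lti_next Sg x1 u1 w1 - lti_next Sg x2 u2 w2)
      - gamma * qform P (x1 - x2)
    <= s (lti_con Sg x1 u1 w1 - lti_con Sg x2 u2 w2,
          lti_opt Sg x1 u1 w1 - lti_opt Sg x2 u2 w2) (u1 - u2, w1 - w2).
Proof.
case=> _ [P [Ppos diss]]; exists P => // x1 u1 w1 x2 u2 w2.
pose tr x u w k := iter k (fun x => lti_next Sg x u w) x.
have trP x u w : lti_system Sg (tr x u w) (fun=> (u, w))
    (fun k => (lti_con Sg (tr x u w k) u w, lti_opt Sg (tr x u w k) u w)).
  by move=> k.
exact: (diss _ _ _ _ _ _ (trP x1 u1 w1) (trP x2 u2 w2) 0%N).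
Qed.

Theorem theorem1 (R : realType) (N : nat) (HN : (1 <= N)%N)
  (n_ nu_ nw_ ny_ nz_ : 'I_N -> nat)
  (Sg : forall i, lti R (n_ i) (nu_ i) (nw_ i) (ny_ i) (nz_ i))
  (phi : forall i, 'cV[R]_(nz_ i) -> 'cV[R]_(nw_ i))
  (M : 'M[R]_(\sum_i nu_ i, \sum_i ny_ i))
  (Hwp : well_posed Sg phi M)
  (Sphi : forall i, 'M[R]_(nz_ i + nw_ i))
  (HSphi : forall i, (Sphi i)^T = Sphi i)
  (Hphi : forall i (z1 z2 : 'cV[R]_(nz_ i)),
     phi_supply (Sphi i) (z1 - z2) (phi i z1 - phi i z2) <= 0)
  (gamma : R) (Hgamma : 0 < gamma < 1)
  (alpha : 'I_N -> R) (Halpha : forall i, 0 < alpha i)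
  (Q_ : forall i, 'M[R]_(ny_ i)) (HQ : forall i, Q_ i = (Q_ i)^T)
  (S_ : forall i, 'M[R]_(ny_ i, nu_ i))
  (R_ : forall i, 'M[R]_(nu_ i)) (HR : forall i, R_ i = (R_ i)^T)
  (Hdiss : forall i, incr_dissipative (lti_system (Sg i))
     (supply (Sphi i) (alpha i) (Q_ i) (S_ i) (R_ i)) gamma)
  (HM : let Q := \mxdiag_i Q_ i in
        let S := rect_mxdiag S_ in
        let T := \mxdiag_i R_ i in
        negsemidef ((col_mx 1%:M M)^T *m block_mx Q S S^T T *m col_mx 1%:M M)) :
  exp_contractive (interconnection Sg phi M) gamma.
Proof.
split=> //.
(* The one-step form of dissipativity fits [interconnection], which asserts the internal signals
   separately at each time. Finite choice over [i] collects the local storage matrices. *)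
have /fin_all_exists2[P Ppos diss] i := lti_dissipative_step (Hdiss i).
exists (\mxdiag_i P i); split; first exact: posdef_mxdiag.
move=> x1 x2 tr1 tr2 _ k.
have [u1 [y1 [z1 [w1 [[alg1 uM1] next1]]]]] := tr1 k.
have [u2 [y2 [z2 [w2 [[alg2 uM2] next2]]]]] := tr2 k.
(* The congruence turns the coupling condition into the supply form at the stacked pair of [y1 - y2]
   and [M *m (y1 - y2)], that is [u1 - u2]. *)
have := HM.2 (y1 - y2); rewrite qform_congr mul_col_mx mul1mx mulmxBr.
(* It remains to bound the storage decrease by the sum of the local supplies, which is done for each
   [i]. *)
rewrite -uM1 -uM2 qform_interconnection; apply: le_trans.
rewrite !qform_mxdiag mulr_sumr -sumrB; apply: ler_sum => i _.
rewrite !submxcolB next1 next2; apply: le_trans (diss _ _ _ _ _ _ _) _.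
have [<- <- w1E] := alg1 i; have [<- <- w2E] := alg2 i.
(* The quadratic supply in the increments of [y] and [u] cancels, leaving only the term in
   [alpha i]; writing each [w] as [phi] of [z] makes the sector condition applicable. *)
rewrite /supply /= gerDr w1E w2E.
by apply: mulr_ge0_le0; [exact/ltW/Halpha|exact: Hphi].
Qed.
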